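(* Let $A$ be any $n\times n$ real symmetric positive definite matrix. If $\kappa(A)\le \sqrt{5+2\sqrt{6}}$, then the Kantorovich function $K(x)=(x^TAx)(x^TA^{-1}x)$ is convex on $\mathbb{R}^n$.
   Context: $\kappa(A)=\lambda_{\max}(A)/\lambda_{\min}(A)$ denotes the condition number of the positive definite matrix $A$, i.e. the ratio of its largest to its smallest eigenvalue. *)

(* Defs.v *)
From mathcomp Require Import all_boot all_order all_algebra.
From mathcomp Require Import all_classical all_reals.
From mathcomp Require Import convex.

Set Implicit Arguments.
Unset Strict Implicit.
Unset Printing Implicit Defensive.

Import Order.TTheory GRing.Theory Num.Theory.
Local Open Scope classical_set_scope.
Local Open Scope ring_scope.

Definition quadform (R : realType) (n : nat) (A : 'M[R]_n) (x : 'cV[R]_n) : R :=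
  (x^T *m A *m x) 0 0.

Definition posdefmx (R : realType) (n : nat) (A : 'M[R]_n) : Prop :=
  forall x : 'cV[R]_n, x != 0 -> 0 < quadform A x.

Definition spectrum (R : realType) (n : nat) (A : 'M[R]_n) : set R :=
  [set a | eigenvalue A a].

(* The spectrum is finite, so as soon as it is nonempty these are the largest
   and the smallest eigenvalue: see lambda_maxP and lambda_minP. *)
Definition lambda_max (R : realType) (n : nat) (A : 'M[R]_n) : R :=
  sup (spectrum A).

Definition lambda_min (R : realType) (n : nat) (A : 'M[R]_n) : R :=
  inf (spectrum A).

(* When n = 0 the spectrum is empty and this is 0 / 0 = 0. *)
Definition condition_number (R : realType) (n : nat) (A : 'M[R]_n) : R :=
  lambda_max A / lambda_min A.

Definition kantorovich (R : realType) (n : nat) (A : 'M[R]_n)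
    (x : 'cV[R]_n) : R :=
  quadform A x * quadform (invmx A) x.

Lemma finite_spectrum (R : realType) (n : nat) (A : 'M[R]_n) :
  finite_set (spectrum A).
Proof.
apply: contrapT => /(infinite_set_fset (size (char_poly A)))[B BA].
apply/negP; rewrite -ltnNge; apply: max_poly_roots => //.
- exact/monic_neq0/char_poly_monic.
- by apply/allP => a /BA; rewrite /spectrum/= eigenvalue_root_char.
- exact: finmap.fset_uniq.
Qed.

Lemma finite_set_has_max (R : realType) (E : set R) :
  finite_set E -> E !=set0 -> exists2 m, E m & ubound E m.
Proof.
move=> /finite_seqP[s ->] [a /= sa].
exists (\big[Num.max/a]_(x <- s) x) => /=.
  rewrite big_seq; elim/big_ind : _ => //= x y xs ys.
  by rewrite /Num.max; case: ifP.
by move=> x /= xs; apply: le_bigmax_seq.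
Qed.

Lemma lambda_maxP (R : realType) (n : nat) (A : 'M[R]_n) :
  spectrum A !=set0 ->
  eigenvalue A (lambda_max A) /\
  forall a, eigenvalue A a -> a <= lambda_max A.
Proof.
move=> A0; have [m Am mA] := finite_set_has_max (finite_spectrum A) A0.
have -> : lambda_max A = m.
  by apply/eqP; rewrite eq_le ge_sup//= ub_le_sup//; exists m.
by split.
Qed.

Lemma lambda_minP (R : realType) (n : nat) (A : 'M[R]_n) :
  spectrum A !=set0 ->
  eigenvalue A (lambda_min A) /\
  forall a, eigenvalue A a -> lambda_min A <= a.
Proof.
move=> [b Ab]; have : finite_set (-%R @` spectrum A).
  exact/finite_image/finite_spectrum.
move=> /finite_set_has_max[|_ [m Am <-] mA]; first by exists (- b), b.
have mP a : eigenvalue A a -> m <= a.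
  by move=> Aa; rewrite -lerN2; apply: mA; exists a.
have -> : lambda_min A = m.
  by apply/eqP; rewrite eq_le ge_inf//= ?lb_le_inf//; [exists b | exists m].
by split.
Qed.

(* Main.v *)
Require Import Defs.
From mathcomp Require Import all_boot all_order all_algebra.
From mathcomp Require Import all_classical all_reals.
From mathcomp Require Import convex.
From mathcomp Require Import interval_inference complex spectral ring lra.

(** Write p, q for the quadratic forms of A and of its inverse. Along a line
with base point x and direction h, half the second derivative of K = p q is

  F(x, h) = p(x,x) q(h,h) + p(h,h) q(x,x) + 4 p(x,h) q(x,h),

so convexity of K amounts to F >= 0. The passage from F >= 0 to convexity
needs no calculus: K is quartic on a line, so F is quadratic in the base point
there, and the convexity gap is a nonnegative combination of two values of F
([convex_quadform_product]).

To prove F >= 0 put p = p(x,x) and q = q(x,x), both positive for x <> 0. Then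

  p q F(x, h) = p q (q p(h,h) + p q(h,h))
                + (q p(x,h) + p q(x,h))^2 - (q p(x,h) - p q(x,h))^2,

and it is enough to bound the last square by the first term. This is the
discriminant of a quadratic polynomial in a real parameter tau, namely

  (q p(h,h) + p q(h,h)) - 2 tau (q p(x,h) - p q(x,h)) + tau^2 p q,

and in coordinates on eigenvectors of A it splits, once its constant
coefficient p q is distributed suitably, into one quadratic form per
eigenvalue t. That such a form is nonnegative is a quadratic inequality in t^2
([spectral_bound]). It holds for all t between m and M as soon as
m^2 + M^2 <= 6 m M, that is as soon as M / m <= 3 + 2 sqrt 2, and
sqrt (5 + 2 sqrt 6) = sqrt 2 + sqrt 3 lies well below this.

Eigenvector coordinates come from the unitary diagonalisation of A over the
complex numbers: the real and imaginary parts of a unitary eigenbasis form a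
family of 2n real eigenvectors, which is not a basis but still resolves the
identity, and sums over it compute both forms ([symmetric_eigenframe],
[bilform_eigenframe]). *)

Set Implicit Arguments.
Unset Strict Implicit.
Unset Printing Implicit Defensive.

Import Order.TTheory GRing.Theory Num.Theory.
Local Open Scope classical_set_scope.
Local Open Scope ring_scope.

(** * Real eigenvectors of a symmetric matrix *)

Section RealSpectral.
Variables (R : rcfType) (n : nat).

Let toC : {rmorphism R -> R[i]} := real_complex R.

Let ReM_real m p q (A : 'M[R[i]]_(m, p)) (B : 'M[R]_(p, q)) :
  map_mx (@complex.Re R) (A *m map_mx toC B) = map_mx (@complex.Re R) A *m B.
Proof.
apply/matrixP => i j; rewrite !mxE.
have ReD : {morph @complex.Re R : x y / x + y >-> x + y} by case=> ? ? [].
rewrite (big_morph _ ReD (erefl : complex.Re 0 = 0)).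
apply: eq_bigr => k _; rewrite !mxE.
by case: (A i k) => a b /=; rewrite mulr0 subr0.
Qed.

Let ImM_real m p q (A : 'M[R[i]]_(m, p)) (B : 'M[R]_(p, q)) :
  map_mx (@complex.Im R) (A *m map_mx toC B) = map_mx (@complex.Im R) A *m B.
Proof.
apply/matrixP => i j; rewrite !mxE.
have ImD : {morph @complex.Im R : x y / x + y >-> x + y} by case=> ? ? [].
rewrite (big_morph _ ImD (erefl : complex.Im 0 = 0)).
apply: eq_bigr => k _; rewrite !mxE.
by case: (A i k) => a b /=; rewrite mulr0 add0r.
Qed.

(** If P is unitary over R[i] and P A = D P with A and D real, then the real part
and the imaginary part of P satisfy the same intertwining relation, and the
real part of P^* P = 1 says that together they resolve the identity. Stacking
them gives twice too many rows, some possibly zero, but avoids choosing a real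
orthonormal eigenbasis. *)
Lemma symmetric_eigenframe (A : 'M[R]_n) : A \is symmetricmx ->
  exists U : 'M[R]_(n + n, n), exists d : 'rV[R]_(n + n),
    [/\ U^T *m U = 1%:M, U *m A = diag_mx d *m U &
        forall i, eigenvalue A (d 0 i)].
Proof.
move=> Asym; pose AC := map_mx toC A.
have ACsym : AC \is symmetricmx.
  have /is_hermitianmxP := Asym; rewrite expr0 scale1r map_mx_id // => AT.
  apply/is_hermitianmxP; rewrite expr0 scale1r map_mx_id //.
  by rewrite /AC {1}AT map_trmx.
have ACreal : AC \is a mxOver Num.real.
  by apply/mxOverP => i j; rewrite mxE complex_real.
have ACh := realsym_hermsym ACsym ACreal.
have /orthomx_spectralP := hermitian_normalmx ACh.
have := hermitian_spectral_diag_real ACh.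
have := spectral_unitarymx AC.
move: (spectralmx AC) (spectral_diag AC) => P D Pu Dr AE.
have PU := unitarymx_unit Pu.
pose d := map_mx (@complex.Re R) D.
have dE : map_mx toC d = D.
  apply/matrixP => i j; rewrite !mxE.
  by have /complex_realP[k ->] := mxOverP Dr i j.
have PA : P *m AC = diag_mx D *m P by rewrite AE !mulmxA mulmxV // mul1mx.
exists (col_mx (map_mx (@complex.Re R) P) (map_mx (@complex.Im R) P)).
(* The real and imaginary parts of a row of P share its eigenvalue. *)
exists (row_mx d d); split.
- have : invmx P *m P = 1%:M by rewrite mulVmx.
  rewrite invmx_unitary // => /matrixP PP.
  rewrite tr_col_mx mul_row_col; apply/matrixP => i j.
  have := congr1 (@complex.Re R) (PP i j); rewrite !mxE.
  have ReD : {morph @complex.Re R : x y / x + y >-> x + y} by case=> ? ? [].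
  rewrite (big_morph _ ReD (erefl : complex.Re 0 = 0)) -big_split /=.
  have -> : complex.Re ((i == j)%:R : R[i]) = (i == j)%:R by case: (i == j).
  move=> <-; apply: eq_bigr => k _; rewrite !mxE.
  have ReJM (x y : R[i]) : complex.Re x * complex.Re y +
      complex.Im x * complex.Im y = complex.Re (x^* * y).
    by case: x => a b; case: y => c e /=; rewrite mulNr opprK.
  exact: ReJM.
- rewrite mul_col_mx -ReM_real -ImM_real -/AC PA.
  rewrite diag_mx_row mul_block_col !mul0mx addr0 add0r.
  have ReMr (x y : R[i]) : x \is Num.real ->
      complex.Re (x * y) = complex.Re x * complex.Re y.
    by move=> /complex_realP[k ->]; case: y => a b /=; rewrite mul0r subr0.
  have ImMr (x y : R[i]) : x \is Num.real ->
      complex.Im (x * y) = complex.Re x * complex.Im y.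
    by move=> /complex_realP[k ->]; case: y => a b /=; rewrite mul0r addr0.
  congr col_mx; apply/matrixP => i j; rewrite !mul_diag_mx !mxE.
    exact/ReMr/(mxOverP Dr).
  exact/ImMr/(mxOverP Dr).
- suff dA i : eigenvalue A (d 0 i).
    by move=> i; rewrite mxE; case: (fintype.split i) => j; exact: dA.
  rewrite -(eigenvalue_map toC) -/AC.
  have -> : toC (d 0 i) = D 0 i by rewrite -dE !mxE.
  apply/eigenvalueP; exists (row i P).
    by rewrite -row_mul PA mul_diag_mx; apply/rowP => j; rewrite !mxE.
  (* A zero row would contradict the invertibility of P. *)
  apply/eqP => Pi0; have := row_free_unit P; rewrite PU => /row_freeP[Q PQ].
  have := congr1 (row i) PQ; rewrite row_mul Pi0 mul0mx => /rowP/(_ i)/eqP.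
  by rewrite !mxE eqxx eq_sym oner_eq0.
Qed.

End RealSpectral.

(** * Bilinear forms and convexity of a product of quadratic forms *)

Definition bilform (R : pzRingType) n (A : 'M[R]_n) (x y : 'cV[R]_n) : R :=
  (x^T *m A *m y) 0 0.

Lemma bilform_comb (R : comPzRingType) n (A : 'M[R]_n) (x y : 'cV[R]_n)
    (a b c e : R) : A^T = A ->
  bilform A (a *: x + b *: y) (c *: x + e *: y) =
  a * c * bilform A x x + (a * e + b * c) * bilform A x y
  + b * e * bilform A y y.
Proof.
move=> AT; have yx : bilform A y x = bilform A x y.
  have yxT : (y^T *m A *m x)^T = x^T *m A *m y.
    by rewrite !trmx_mul trmxK AT mulmxA.
  by rewrite /bilform -yxT [RHS]mxE.
have Dl u v w : bilform A (u + v) w = bilform A u w + bilform A v w.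
  by rewrite /bilform linearD !mulmxDl [LHS]mxE.
have Dr u v w : bilform A u (v + w) = bilform A u v + bilform A u w.
  by rewrite /bilform mulmxDr [LHS]mxE.
have Zl k u v : bilform A (k *: u) v = k * bilform A u v.
  by rewrite /bilform linearZ -!scalemxAl [LHS]mxE.
have Zr k u v : bilform A u (k *: v) = k * bilform A u v.
  by rewrite /bilform -scalemxAr [LHS]mxE.
by rewrite !(Dl, Dr, Zl, Zr) yx; ring.
Qed.

(** Half the second derivative at x, in the direction h, of the product of the
quadratic forms of symmetric matrices P and Q. *)
Definition half_hessian (R : pzRingType) n (P Q : 'M[R]_n) (x h : 'cV[R]_n) : R :=
  bilform P x x * bilform Q h h + bilform P h h * bilform Q x x
  + 4 * (bilform P x h * bilform Q x h).

(** For a C^2 function g on [0,1] the gap t g(0) + s g(1) - g(s), with t + s = 1,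
is t s / 2 times the mean of g'' for the triangular density with corners
0, s, 1. Here g'' is twice a quadratic polynomial with leading coefficient
F(h,h), so this mean only involves the expectation (1 + s) / 3 and the variance
(1 - s + s^2) / 18 of that density. The resulting identity is polynomial and is
checked as such. *)
Lemma convex_quadform_product (R : realType) n (P Q : 'M[R]_n) :
  P^T = P -> Q^T = Q -> (forall x h, 0 <= half_hessian P Q x h) ->
  convex_function [set: 'cV[R]_n] (fun x => quadform P x * quadform Q x).
Proof.
move=> PT QT hess_ge0 t x y _ _; rewrite -subr_ge0 convRE.
rewrite -[conv t x y]/(t%:num *: x + (1 - t%:num) *: y).
have quadE A z : quadform A z = bilform A z z :> R by [].
rewrite /unstable.onem.
have : 0 <= t%:num by [].
have : t%:num <= 1 by [].
move: (t%:num) => {}t t1 t0.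
pose s := 1 - t; pose h := (-1) *: x + 1 *: y.
have := hess_ge0 ((1 - (1 + s) / 3) *: x + ((1 + s) / 3) *: y) h.
have := hess_ge0 h h.
rewrite /half_hessian /h !bilform_comb // => Fhh Fwh.
rewrite !quadE !bilform_comb //.
(* The two placeholders are F at the mean point and F(h,h). *)
apply: le_trans (_ : 0 <= t * s * (_ + (1 - s + s ^+ 2) / 18 * _)) _.
  apply: mulr_ge0; first by apply: mulr_ge0; rewrite ?subr_ge0.
  apply: addr_ge0; first exact: Fwh.
  by apply: mulr_ge0 Fhh; apply: mulr_ge0; rewrite ?invr_ge0 //; nra.
by rewrite le_eqVlt; apply/orP; left; apply/eqP; rewrite /s; field.
Qed.

(** * The second derivative in diagonal coordinates *)

Section Diagonal.
Variables (R : realFieldType).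

Lemma quadratic_ge0 (a b c : R) u v :
  0 < a -> b ^+ 2 <= a * c -> 0 <= a * v ^+ 2 - 2 * b * (u * v) + c * u ^+ 2.
Proof.
move=> a0 bac; rewrite -(pmulr_rge0 _ a0).
have -> : a * (a * v ^+ 2 - 2 * b * (u * v) + c * u ^+ 2) =
  (a * v - b * u) ^+ 2 + (a * c - b ^+ 2) * u ^+ 2 by ring.
by rewrite addr_ge0 ?sqr_ge0 // mulr_ge0 ?sqr_ge0 ?subr_ge0.
Qed.

Variables (I : finType) (d u v : I -> R) (m M : R).
Hypotheses (m_gt0 : 0 < m) (dm : forall i, m <= d i <= M).
Hypothesis mM : m ^+ 2 + M ^+ 2 <= 6 * (m * M).

(** With k = m M and z = t^2 the difference of the two sides is, up to a positive
factor, 3 (p^2 + q^2 k^2) z - p q (z^2 + k^2). The arithmetic-geometric mean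
inequality bounds p^2 + q^2 k^2 below by 2 p q k, and z^2 + k^2 <=
(m^2 + M^2) z because z lies between m^2 and M^2, whose product is k^2. Thus
6 k >= m^2 + M^2 suffices. The weights q^2 k^2 and p^2 are the ones that make
the two roots in z multiply to k^2. *)
Lemma spectral_bound (p q t : R) : 0 < p -> 0 < q -> m <= t <= M ->
  (q * t - p * t^-1) ^+ 2 <= (q * t + p * t^-1) *
   ((q ^+ 2 * (m * M) ^+ 2 * (q * t) + p ^+ 2 * (p * t^-1))
     / (p ^+ 2 + q ^+ 2 * (m * M) ^+ 2)).
Proof.
move=> p0 q0 /andP[mt tM]; have t0 : 0 < t by apply: lt_le_trans mt.
have M0 : 0 < M by apply: lt_le_trans tM.
set k := m * M; have k0 : 0 < k by apply: mulr_gt0.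
set W := p ^+ 2 + _; have W0 : 0 < W by rewrite /W addr_gt0 ?mulr_gt0 ?exprn_gt0.
rewrite -subr_ge0.
have -> : (q * t + p * t^-1) *
   ((q ^+ 2 * k ^+ 2 * (q * t) + p ^+ 2 * (p * t^-1)) / W)
   - (q * t - p * t^-1) ^+ 2 =
   p * q / (W * t ^+ 2) * (3 * (p - q * k) ^+ 2 * t ^+ 2
    + p * q * ((6 * k - (m ^+ 2 + M ^+ 2)) * t ^+ 2
              + (t ^+ 2 - m ^+ 2) * (M ^+ 2 - t ^+ 2))).
  rewrite /W /k; field; rewrite gt_eqF //=.
  by rewrite exprMn gt_eqF.
have P x y : 0 < x -> x <= y -> x ^+ 2 <= y ^+ 2.
  by move=> x0 xy; rewrite ler_pXn2r // nnegrE ltW // (lt_le_trans x0).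
apply: mulr_ge0.
  by apply/ltW; rewrite divr_gt0 ?mulr_gt0 ?exprn_gt0.
apply: addr_ge0; first by rewrite mulr_ge0 ?sqr_ge0 // mulr_ge0 ?sqr_ge0.
apply: mulr_ge0; first by rewrite mulr_ge0 // ltW.
by rewrite addr_ge0 // mulr_ge0 ?sqr_ge0 ?subr_ge0 ?P.
Qed.

(** The parameter tau stands for a discriminant argument: for each i the quadratic
form in v i and tau * u i is nonnegative by [spectral_bound], and the sum over
i is a quadratic polynomial in tau whose minimum falls short of the claimed
quantity by a square divided by p * q. *)
Lemma diagonal_half_hessian_ge0 :
  let p := \sum_i d i * (u i * u i) in let q := \sum_i (d i)^-1 * (u i * u i) in
  0 < p -> 0 < q ->
  0 <= p * (\sum_i (d i)^-1 * (v i * v i)) + (\sum_i d i * (v i * v i)) * q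
     + 4 * ((\sum_i d i * (u i * v i)) * (\sum_i (d i)^-1 * (u i * v i))).
Proof.
move=> p q p0 q0.
set qv := \sum_i (d i)^-1 * (v i * v i); set pv := \sum_i d i * (v i * v i).
set puv := \sum_i d i * (u i * v i); set quv := \sum_i (d i)^-1 * (u i * v i).
set W := p ^+ 2 + q ^+ 2 * (m * M) ^+ 2.
have W0 : 0 < W by rewrite ltr_wpDr ?exprn_gt0 // mulr_ge0 ?sqr_ge0.
pose al := q ^+ 2 * (m * M) ^+ 2 / W; pose be := p ^+ 2 / W.
(* The weights al and be sum to 1, so al * q * p + be * p * q is a way of
   distributing the constant coefficient p * q over the indices. *)
have key tau : 0 <= (q * pv + p * qv) - 2 * tau * (q * puv - p * quv)
   + tau ^+ 2 * (p * q).
  have -> : p * q = al * q * p + be * p * q.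
    by rewrite /al /be /W; field; rewrite exprMn gt_eqF.
  suff -> : (q * pv + p * qv) - 2 * tau * (q * puv - p * quv)
   + tau ^+ 2 * (al * q * p + be * p * q) =
   \sum_i ((q * d i + p * (d i)^-1) * v i ^+ 2
     - 2 * (tau * (q * d i - p * (d i)^-1)) * (u i * v i)
     + (tau ^+ 2 * ((q ^+ 2 * (m * M) ^+ 2 * (q * d i) + p ^+ 2 * (p * (d i)^-1))
        / W)) * u i ^+ 2).
    apply: sumr_ge0 => i _; have di0 : 0 < d i.
      by case/andP: (dm i) => + _; exact: lt_le_trans.
    apply: quadratic_ge0; first by rewrite addr_gt0 ?mulr_gt0 ?invr_gt0.
    by rewrite exprMn [leRHS]mulrCA; apply: ler_wpM2l; rewrite ?sqr_ge0 ?spectral_bound.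
  under [RHS]eq_bigr => i _.
    rewrite (_ : _ + _ = q * (d i * (v i * v i)) + p * ((d i)^-1 * (v i * v i))
      + (- (2 * tau * q)) * (d i * (u i * v i))
      + (2 * tau * p) * ((d i)^-1 * (u i * v i))
      + (tau ^+ 2 * (al * q)) * (d i * (u i * u i))
      + (tau ^+ 2 * (be * p)) * ((d i)^-1 * (u i * u i))); last first.
      by rewrite /al /be; ring.
    over.
  rewrite !big_split /= -!mulr_sumr -/p -/q -/pv -/qv -/puv -/quv; ring.
(* The minimiser of the quadratic polynomial in tau. *)
pose T := (q * puv - p * quv) / (p * q).
have := key T.
have -> : (q * pv + p * qv) - 2 * T * (q * puv - p * quv)
   + T ^+ 2 * (p * q) = (p * qv + pv * q + 4 * (puv * quv))
     - (q * puv + p * quv) ^+ 2 / (p * q).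
  by rewrite /T; field; rewrite !gt_eqF.
rewrite subr_ge0; apply: le_trans.
by rewrite divr_ge0 ?sqr_ge0 // mulr_ge0 // ltW.
Qed.

End Diagonal.

(** * Positive definite matrices with a narrow spectrum *)

Lemma posdef_eigenvalue_gt0 (R : realType) n (A : 'M[R]_n) a :
  posdefmx A -> eigenvalue A a -> 0 < a.
Proof.
move=> Apos /eigenvalueP[v vA v0].
have vT0 : v^T != 0 by apply: contra_neq v0 => /(congr1 trmx); rewrite trmxK trmx0.
have := Apos _ vT0; rewrite /quadform trmxK vA -scalemxAl mxE.
have vv0 : 0 <= (v *m v^T) 0 0.
  by rewrite mxE sumr_ge0 // => i _; rewrite mxE -expr2 sqr_ge0.
by rewrite !ltNge => /negP avv; apply/negP => a0; apply: avv; rewrite mulr_le0_ge0.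
Qed.

Lemma posdef_unitmx (R : realType) n (A : 'M[R]_n) : posdefmx A -> A \in unitmx.
Proof.
move=> Apos; rewrite -row_free_unit -kermx_eq0.
have -> : kermx A = eigenspace A 0 by rewrite /eigenspace raddf0 subr0.
by apply: contraT => /(posdef_eigenvalue_gt0 Apos); rewrite ltxx.
Qed.

Lemma bilform_eigenframe (R : comPzRingType) N n (U : 'M[R]_(N, n)) (d : 'rV[R]_N)
    (A : 'M[R]_n) (x y : 'cV[R]_n) :
  U^T *m U = 1%:M -> U *m A = diag_mx d *m U ->
  bilform A x y = \sum_i d 0 i * ((U *m x) i 0 * (U *m y) i 0).
Proof.
move=> UU UA; have -> : A = U^T *m diag_mx d *m U.
  by rewrite -mulmxA -UA mulmxA UU mul1mx.
rewrite /bilform !mulmxA -trmx_mul.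
rewrite -!mulmxA mxE; apply: eq_bigr => i _.
by rewrite mul_diag_mx !mxE mulrCA.
Qed.

(** The same frame serves for the inverse, with inverted eigenvalues: this is what
makes the two forms of the Kantorovich function simultaneously diagonal. *)
Lemma eigenframe_invmx (R : fieldType) N n (U : 'M[R]_(N, n)) (d : 'rV[R]_N)
    (A : 'M[R]_n) :
  A \in unitmx -> (forall i, d 0 i != 0) -> U *m A = diag_mx d *m U ->
  U *m invmx A = diag_mx (map_mx (fun a => a^-1) d) *m U.
Proof.
move=> Au d0 UA; apply: (can_inj (mulmxK Au)).
rewrite mulmxKV // -mulmxA UA; apply/matrixP => i j.
by rewrite !mul_diag_mx !mxE mulKf.
Qed.

Lemma kantorovich_half_hessian_ge0 (R : realType) n (A : 'M[R]_n) (m M : R) :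
  A \is symmetricmx -> posdefmx A ->
  (forall a, eigenvalue A a -> m <= a <= M) -> 0 < m ->
  m ^+ 2 + M ^+ 2 <= 6 * (m * M) ->
  forall x h, x != 0 -> 0 <= half_hessian A (invmx A) x h.
Proof.
move=> Asym Apos AmM m0 mM x h x0.
have [U [d [UU UA dA]]] := symmetric_eigenframe Asym.
have d0 i : 0 < d 0 i := posdef_eigenvalue_gt0 Apos (dA i).
have UV := eigenframe_invmx (posdef_unitmx Apos) (fun i => lt0r_neq0 (d0 i)) UA.
have [i Uxi] : exists i, (U *m x) i 0 != 0.
  apply/existsP; apply: contraNT x0; rewrite negb_exists => /forallP Ux0.
  rewrite -[x]mul1mx -UU -mulmxA [U *m x](_ : _ = 0) ?mulmx0 //.
  by apply/colP => i; rewrite [RHS]mxE; apply/eqP; have := Ux0 i; rewrite negbK.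
have sum_gt0 (e : 'I_(n + n) -> R) : (forall i, 0 < e i) ->
    0 < \sum_i e i * ((U *m x) i 0 * (U *m x) i 0).
  move=> e0; rewrite (bigD1 i) //= ltr_wpDr //.
    by rewrite sumr_ge0 // => j _; rewrite -expr2 mulr_ge0 ?sqr_ge0 // ltW.
  by rewrite -expr2 mulr_gt0 // lt0r sqr_ge0 sqrf_eq0 Uxi.
have := @diagonal_half_hessian_ge0 _ _ (fun i => d 0 i) (fun i => (U *m x) i 0)
  (fun i => (U *m h) i 0) m M m0 (fun i => AmM _ (dA i)) mM
  (sum_gt0 _ d0) (sum_gt0 (fun i => (d 0 i)^-1) _).
have AE y z := bilform_eigenframe y z UU UA.
have VE y z : bilform (invmx A) y z =
    \sum_i (d 0 i)^-1 * ((U *m y) i 0 * (U *m z) i 0).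
  by rewrite (bilform_eigenframe y z UU UV); apply: eq_bigr => j _; rewrite mxE.
rewrite /half_hessian !AE !VE.
by apply=> j; rewrite invr_gt0.
Qed.

(** The exact value is sqrt 2 + sqrt 3. For a ratio r >= 1 the condition
r^2 + 1 <= 6 r follows from (r - 1) (r - 5) <= 0, so 5 is a convenient bound. *)
Lemma sqrt_5_2sqrt6_le5 (R : rcfType) : Num.sqrt (5 + 2 * Num.sqrt 6) <= 5 :> R.
Proof.
have s6 : Num.sqrt 6 <= 3 :> R.
  by rewrite -[leRHS]ger0_norm // -sqrtr_sqr ler_wsqrtr //; lra.
by rewrite -[leRHS]ger0_norm // -sqrtr_sqr ler_wsqrtr //; lra.
Qed.

Theorem theorem2p1 (R : realType) (n : nat) (A : 'M[R]_n)
    (A_sym : A \is symmetricmx) (A_posdef : posdefmx A)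
    (kappaA : condition_number A <= Num.sqrt (5 + 2 * Num.sqrt 6)) :
  convex_function [set: 'cV[R]_n] (kantorovich A).
Proof.
have AT : A^T = A.
  by have /is_hermitianmxP := A_sym; rewrite expr0 scale1r map_mx_id.
apply: convex_quadform_product; rewrite ?trmx_inv ?AT // => x h.
have [->|x0] := eqVneq x 0.
  by rewrite /half_hessian /bilform trmx0 !mul0mx !mxE !(mul0r, mulr0, addr0).
(* Since x <> 0 the dimension is positive, so the frame has at least one row. *)
have sp : spectrum A !=set0.
  have [U [d [UU _ dA]]] := symmetric_eigenframe A_sym.
  case: n => [|k] in A A_sym A_posdef kappaA AT x h x0 U d UU dA *.
    by move: x0; rewrite [x]flatmx0 eqxx.
  by exists (d 0 ord0); exact: dA.
have [Am mle] := lambda_minP sp; have [AM leM] := lambda_maxP sp.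
have m0 := posdef_eigenvalue_gt0 A_posdef Am.
have M5 : lambda_max A <= 5 * lambda_min A.
  by rewrite -ler_pdivrMr //; exact: le_trans kappaA (sqrt_5_2sqrt6_le5 R).
apply: (@kantorovich_half_hessian_ge0 _ _ A (lambda_min A) (lambda_max A)) => //.
  by move=> a Aa; rewrite mle // leM.
have := mle _ AM; nra.
Qed.
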